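(* Consider the robust Bayesian persuasion setting described in the context. For every number of states $n$ and every prior $\mu\in\Delta([n])$ with full support, $$1-\frac{2}{\sqrt{n}}\le \mathrm{Reg}_{\mathrm{AR}}\le 1-\frac{1}{4n^2}.$$
   Context: Setting: a finite state space $\Omega=[n]=\{1,\dots,n\}$ and a publicly known prior $\mu\in\Delta(\Omega)$ with $\mu_i>0$ for all $i$. A signaling scheme is a stochastic map $\pi$ from $\Omega$ to a (finite or infinite) signal set $S$; Sender commits to $\pi$, the state $\omega\sim\mu$ is drawn, a signal $s\sim\pi(\omega)$ is sent, and Receiver forms the Bayesian posterior $p(s)\in\Delta(\Omega)$. Receiver has actions $\{0,1\}$ (reject/adopt) and utility $u_r:\Omega\times\{0,1\}\to\mathbb{R}$ with $u_r(i,0)=0$ for all $i$; Receiver adopts at posterior $p$ iff $\mathbb{E}_{\omega'\sim p}[u_r(\omega',1)]\ge 0$ (ties broken in favor of adoption). Sender's utility from $\pi$ is $u(\pi,u_r)=\Pr_{s}[\text{Receiver adopts at } p(s)]$. Let $u^*(u_r)=\sup_\pi u(\pi,u_r)$. For a class $\mathcal{U}$ of Receiver utilities, $\mathrm{Reg}(\pi)=\sup_{u_r\in\mathcal{U}}\{u^*(u_r)-u(\pi,u_r)\}$ and $\mathrm{Reg}=\inf_\pi \mathrm{Reg}(\pi)$. $\mathrm{Reg}_{\mathrm{AR}}$ denotes this regret when $\mathcal{U}$ is the class of all Receiver utility functions. *)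

(* Defs.v *)
From HB Require Import structures.
From mathcomp Require Import all_boot all_order all_algebra.
From mathcomp Require Import all_classical all_reals all_analysis.
Set Implicit Arguments. Unset Strict Implicit. Unset Printing Implicit Defensive.
Import Order.TTheory GRing.Theory Num.Theory.
Local Open Scope classical_set_scope.
Local Open Scope ring_scope.

(* States Omega = [n] are represented by 'I_n.  A prior is mu : 'I_n -> R.
   A Receiver utility u_r with u_r(i,0) = 0 is determined by ur i := u_r(i,1). *)

(* A signaling scheme with signal space S (an arbitrary measurable space,
   finite or infinite): for each state i a probability measure sig i on S
   (the law of the signal given omega = i), together with a (version of the)
   Bayesian posterior post s : Delta([n]), characterised by Bayes' rule:
   for every measurable B and state i,
     \int_B post(.)_i d(nu) = mu_i * sig_i(B),  where nu = \sum_j mu_j sig_j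
   is the (marginal) law of the signal.  Such a version always exists
   (Radon-Nikodym) and any two versions agree nu-a.e., so quantifying over
   (sig, post) is the same as quantifying over signaling schemes. *)
Record scheme (R : realType) (n : nat) (mu : 'I_n -> R)
    (d : measure_display) (S : measurableType d) := Scheme {
  sig : 'I_n -> probability S R ;
  post : S -> 'I_n -> R ;
  post_meas : forall i, measurable_fun setT (fun s => post s i) ;
  post_ge0 : forall s i, 0 <= post s i ;
  post_sum1 : forall s, \sum_(i < n) post s i = 1 ;
  post_bayes : forall (i : 'I_n) (B : set S), measurable B ->
    (\sum_(j < n) (mu j)%:E * \int[sig j]_(s in B) (post s i)%:E
       = (mu i)%:E * sig i B)%E
}.

Definition adopts (R : realType) (n : nat) (ur : 'I_n -> R) (p : 'I_n -> R) : bool :=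
  0 <= \sum_(i < n) p i * ur i.

Definition sender_util (R : realType) (n : nat) (mu : 'I_n -> R)
    (d : measure_display) (S : measurableType d) (pi : scheme mu S)
    (ur : 'I_n -> R) : R :=
  \sum_(j < n) mu j * fine (sig pi j [set s | adopts ur (post pi s)]).

Definition achievable (R : realType) (n : nat) (mu : 'I_n -> R) (ur : 'I_n -> R)
  : set R :=
  [set x | exists (d : measure_display) (S : measurableType d) (pi : scheme mu S),
           x = sender_util pi ur].

Definition opt_util (R : realType) (n : nat) (mu : 'I_n -> R) (ur : 'I_n -> R) : R :=
  sup (achievable mu ur).

Definition regret (R : realType) (n : nat) (mu : 'I_n -> R)
    (d : measure_display) (S : measurableType d) (pi : scheme mu S) : R :=
  sup [set opt_util mu ur - sender_util pi ur | ur in [set: 'I_n -> R]].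

Definition Reg_AR (R : realType) (n : nat) (mu : 'I_n -> R) : R :=
  inf [set x | exists (d : measure_display) (S : measurableType d) (pi : scheme mu S),
               x = regret pi].

(* Main.v *)
(* In any scheme the adopted masses q_i = mu_i * Pr[adopt | i] satisfy
   sum_i q_i ur_i >= 0.

   Upper bound.  Put eps = 1/(4n^2), v_i = max(0, mu_i - eps), and send n + 1
   signals with joint masses v/(n+1) and v/(n+1) + (mu_k - v_k) e_k, each of
   total mass at least eps.  If none is adopted and some scheme has utility
   above 1 - eps, its adopted masses q satisfy v <= q <= mu, so q lies in the
   cone of the signals and sum_i q_i ur_i < 0, a contradiction.

   Lower bound.  Let k = floor(sqrt n) and let L be a set of k + 1 states with
   mu(L) <= (k+1)/n.  For i in L take a utility that likes only i and strongly
   dislikes L \ {i}.  Revealing whether the state is in L \ {i} gets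
   1 - mu(L \ {i}), while a fixed scheme is adopted on disjoint events for
   distinct i in L; averaging over L, the regret is at least
   1 - k/n - 1/(k+1) >= 1 - 2/sqrt n. *)
Require Import Defs.
From HB Require Import structures.
From mathcomp Require Import all_boot all_order all_algebra.
From mathcomp Require Import all_classical all_reals all_analysis.
From mathcomp Require Import measurable_realfun ring lra.
Set Implicit Arguments. Unset Strict Implicit. Unset Printing Implicit Defensive.
Import Order.TTheory GRing.Theory Num.Theory.
Local Open Scope ring_scope.

(** * Adoption events and obedience *)

Lemma measurable_adopts (R : realType) (n : nat) (mu : 'I_n -> R)
    (d : measure_display) (S : measurableType d) (pi : scheme mu S)
    (ur : 'I_n -> R) :
  measurable [set s | adopts ur (post pi s)]%classic.
Proof.
have mf : measurable_fun setT (fun s => \sum_(i < n) post pi s i * ur i).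
  apply: measurable_sum => i; apply: measurable_funM; first exact: post_meas.
  exact: measurable_cst.
have := mf measurableT `[0, +oo[%classic (measurable_itv _).
rewrite setTI; congr (measurable _).
by apply/seteqP; split => s /=; rewrite in_itv /= andbT.
Qed.

Definition adopt_prob {R : realType} {n : nat} {mu : 'I_n -> R}
    {d : measure_display} {S : measurableType d} (pi : scheme mu S)
    (ur : 'I_n -> R) (j : 'I_n) : R :=
  fine (sig pi j [set s | adopts ur (post pi s)]%classic).

Lemma adopt_prob_itv (R : realType) (n : nat) (mu : 'I_n -> R)
    (d : measure_display) (S : measurableType d) (pi : scheme mu S)
    (ur : 'I_n -> R) (j : 'I_n) :
  0 <= adopt_prob pi ur j <= 1.
Proof.
rewrite /adopt_prob fine_ge0 //=.
rewrite -[1]/(fine 1%E) fine_le ?fin_num_measure ?probability_le1 //;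
  exact: measurable_adopts.
Qed.

Lemma sender_util_le1 (R : realType) (n : nat) (mu : 'I_n -> R)
    (mu_pos : forall i, 0 < mu i) (mu_sum1 : \sum_(i < n) mu i = 1)
    (d : measure_display) (S : measurableType d) (pi : scheme mu S)
    (ur : 'I_n -> R) :
  sender_util pi ur <= 1.
Proof.
rewrite -mu_sum1; apply: ler_sum => j _.
rewrite ler_piMr ?(ltW (mu_pos j)) //.
by case/andP: (adopt_prob_itv pi ur j).
Qed.

Lemma sender_util_ge0 (R : realType) (n : nat) (mu : 'I_n -> R)
    (mu_pos : forall i, 0 < mu i)
    (d : measure_display) (S : measurableType d) (pi : scheme mu S)
    (ur : 'I_n -> R) :
  0 <= sender_util pi ur.
Proof.
apply: sumr_ge0 => j _; rewrite mulr_ge0 ?(ltW (mu_pos j)) //.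
by case/andP: (adopt_prob_itv pi ur j).
Qed.

Lemma post_integrable (R : realType) (n : nat) (mu : 'I_n -> R)
    (d : measure_display) (S : measurableType d) (pi : scheme mu S)
    (i j : 'I_n) (A : set S) :
  measurable A -> (sig pi j).-integrable A (fun s => (post pi s i)%:E).
Proof.
move=> mA; apply: measurable_bounded_integrable => //.
- by rewrite (le_lt_trans (probability_le1 _ mA)) // ltry.
- exact: measurable_funS (post_meas pi i).
- exists 1; split; first exact: num_real.
  move=> x x1 s _ /=; rewrite ger0_norm ?post_ge0 // (le_trans _ (ltW x1)) //.
  rewrite -(post_sum1 pi s) (bigD1 i) //= lerDl.
  by apply: sumr_ge0 => k _; exact: post_ge0.
Qed.

(** Bayes' rule on the adoption event [A] writes each adopted mass as an integral of the posterior
    over [A]. After exchanging sum and integral, the integrand is the Receiver's expected utility,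
    nonnegative on [A] by definition. *)
Lemma obedience (R : realType) (n : nat) (mu : 'I_n -> R)
    (mu_pos : forall i, 0 < mu i)
    (d : measure_display) (S : measurableType d) (pi : scheme mu S)
    (ur : 'I_n -> R) :
  0 <= \sum_(i < n) mu i * adopt_prob pi ur i * ur i.
Proof.
set A := [set s | adopts ur (post pi s)]%classic.
have mA : measurable A by exact: measurable_adopts.
have bayesR i : mu i * adopt_prob pi ur i =
    \sum_(j < n) mu j * \int[sig pi j]_(s in A) post pi s i.
  apply/EFin_inj; rewrite EFinM fineK ?fin_num_measure // -post_bayes //.
  rewrite -sumEFin; apply: eq_bigr => j _.
  by rewrite EFinM fineK // integrable_fin_num //; exact: post_integrable.
under eq_bigr do rewrite bayesR mulr_suml.
rewrite exchange_big /=; apply: sumr_ge0 => j _.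
under eq_bigr do rewrite -mulrA.
rewrite -mulr_sumr mulr_ge0 ?(ltW (mu_pos j)) //.
have -> : \sum_(i < n) \int[sig pi j]_(s in A) post pi s i * ur i =
    \int[sig pi j]_(s in A) \sum_(i < n) (post pi s i * ur i).
  apply/EFin_inj; rewrite -sumEFin fineK; last first.
    apply: integrable_fin_num => //.
    under eq_fun do rewrite -sumEFin.
    apply: integrable_sum => // i _.
    under eq_fun do rewrite mulrC EFinM.
    by apply: integrableZl => //; exact: post_integrable.
  under [in RHS]eq_integral do rewrite -sumEFin.
  rewrite integral_sum //; last first.
    move=> i; under eq_fun do rewrite mulrC EFinM.
    by apply: integrableZl => //; exact: post_integrable.
  apply: eq_bigr => i _.
  under [in RHS]eq_integral do rewrite mulrC EFinM.
  rewrite integralZl //; last exact: post_integrable.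
  by rewrite mulrC EFinM fineK // integrable_fin_num //; exact: post_integrable.
by apply: Rintegral_ge0 => s.
Qed.

(** * Schemes with finitely many signals *)

Lemma discrete_probability (R : realType) (m : nat) (p : nat -> R)
    (p_ge0 : forall s, 0 <= p s) (p_sum1 : \sum_(s < m) p s = 1) :
  exists P : probability nat R,
    forall (B : set nat) (f : nat -> R), (forall s, 0 <= f s) ->
      (\int[P]_(s in B) (f s)%:E = (\sum_(s < m) p s * (\1_B s * f s))%:E)%E.
Proof.
pose M : measure nat R := msum (fun s => mscale (NngNum (p_ge0 s)) \d_s) m.
have M1 : M setT = 1%E.
  rewrite /M /= /msum /= -p_sum1 -sumEFin; apply: eq_bigr => s _.
  by rewrite /mscale /= diracT mule1.
pose P : probability nat R :=
  HB.pack_for (probability nat R) (Measure.sort M)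
    (Measure_isProbability.Build _ _ _ M M1).
exists P => B f f0.
have f0E s : B s -> (0%E <= (f s)%:E)%E by rewrite lee_fin.
rewrite (eq_measure_integral M) //.
rewrite ge0_integral_measure_sum //.
rewrite -sumEFin; apply: eq_bigr => s _.
by rewrite (ge0_integral_mscale _ _ _ _ f0E) // integral_dirac.
Qed.

(** [w s i] is the joint mass of signal [s] and state [i], so the posterior is [w s] normalised, and
    adoption can be tested on [w s] itself since a positive factor keeps the sign. Only signals
    below [m] are sent; [w_pos] ranges over all of [nat] because a posterior must be a distribution
    at null signals too. *)
Lemma discrete_scheme (R : realType) (n m : nat) (mu : 'I_n -> R)
    (mu_pos : forall i, 0 < mu i) (w : nat -> 'I_n -> R)
    (w_ge0 : forall s i, 0 <= w s i)
    (w_pos : forall s, 0 < \sum_(i < n) w s i)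
    (w_sum : forall i, \sum_(s < m) w s i = mu i) :
  exists pi : scheme mu nat, forall ur : 'I_n -> R,
    sender_util pi ur =
      \sum_(s < m | 0 <= \sum_(i < n) w s i * ur i) \sum_(i < n) w s i.
Proof.
pose tot s := \sum_(i < n) w s i.
have [sg sgE] : exists sg : 'I_n -> probability nat R,
    forall i (B : set nat) (f : nat -> R), (forall s, 0 <= f s) ->
      (\int[sg i]_(s in B) (f s)%:E =
        (\sum_(s < m) (w s i / mu i) * (\1_B s * f s))%:E)%E.
  suff /choice[sg sgE] : forall i, exists P : probability nat R,
      forall (B : set nat) (f : nat -> R), (forall s, 0 <= f s) ->
      (\int[P]_(s in B) (f s)%:E =
        (\sum_(s < m) (w s i / mu i) * (\1_B s * f s))%:E)%E by exists sg.
  move=> i.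
  apply: (@discrete_probability R m (fun s => w s i / mu i)) => [s|].
    by rewrite divr_ge0 // ltW.
  by rewrite -mulr_suml w_sum divff // gt_eqF.
have sgP i (B : set nat) :
    sg i B = (\sum_(s < m) (w s i / mu i) * \1_B s)%:E.
  rewrite -[LHS]mul1e -integral_cst // (sgE i B (fun=> 1)) //.
  by congr (_%:E); apply: eq_bigr => s _; rewrite mulr1.
have muK (i : 'I_n) x : mu i * (x / mu i) = x by field; rewrite gt_eqF.
have Hge0 s i : 0 <= w s i / tot s by rewrite divr_ge0 // ltW // w_pos.
have Hsum s : \sum_(i < n) w s i / tot s = 1.
  by rewrite -mulr_suml divff // gt_eqF // w_pos.
have Hmeas i : measurable_fun setT (fun s : nat => w s i / tot s) by [].
have Hbayes (i : 'I_n) (B : set nat) : measurable B ->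
    (\sum_(j < n) (mu j)%:E * \int[sg j]_(s in B) (w s i / tot s)%:E
       = (mu i)%:E * sg i B)%E.
  move=> _; rewrite sgP.
  under eq_bigr do rewrite sgE // -EFinM mulr_sumr.
  rewrite sumEFin -EFinM; congr (_%:E).
  (* Summing over states first produces [tot s], which cancels the denominator of the posterior. *)
  rewrite exchange_big /= mulr_sumr; apply: eq_bigr => s _.
  under eq_bigr do rewrite mulrA muK.
  rewrite -mulr_suml -/(tot s) [in RHS]mulrA muK.
  by field; rewrite gt_eqF // w_pos.
exists (Scheme Hmeas Hge0 Hsum Hbayes) => ur.
rewrite /sender_util /=.
under eq_bigr do rewrite sgP /= mulr_sumr.
rewrite exchange_big [RHS]big_mkcond /=; apply: eq_bigr => s _.
under eq_bigr do rewrite mulrA muK.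
rewrite -mulr_suml indicE.
have -> : ((s : nat) \in [set s0 | adopts ur ((fun i => w s0 i / tot s0))]%classic)
    = (0 <= \sum_(i < n) w s i * ur i).
  have -> : (0 <= \sum_(i < n) w s i * ur i) =
      adopts ur (fun i => w s i / tot s).
    rewrite /adopts; under [in RHS]eq_bigr do rewrite mulrAC.
    by rewrite -mulr_suml pmulr_lge0 // invr_gt0 w_pos.
  by apply/idP/idP => [/set_mem//|?]; exact: mem_set.
by case: ifP => _; rewrite ?mulr1 ?mulr0.
Qed.

(** * Optimal utility and regret as suprema *)

Lemma prior_size_gt0 (R : realType) (n : nat) (mu : 'I_n -> R) :
  \sum_(i < n) mu i = 1 -> (0 < n)%N.
Proof.
by case: n mu => // mu; rewrite big_ord0 => /eqP; rewrite eq_sym oner_eq0.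
Qed.

Lemma achievable_neq0 (R : realType) (n : nat) (mu : 'I_n -> R)
    (mu_pos : forall i, 0 < mu i) (mu_sum1 : \sum_(i < n) mu i = 1)
    (ur : 'I_n -> R) : (achievable mu ur !=set0)%classic.
Proof.
(* The uninformative scheme: one signal carrying the whole prior. *)
have [||i|pi _] := @discrete_scheme R n 1 mu mu_pos (fun=> mu).
- by move=> _ i; exact: ltW.
- by move=> _; rewrite mu_sum1.
- by rewrite big_ord1.
by exists (sender_util pi ur); do 3 eexists.
Qed.

Lemma sender_util_le_opt (R : realType) (n : nat) (mu : 'I_n -> R)
    (mu_pos : forall i, 0 < mu i) (mu_sum1 : \sum_(i < n) mu i = 1)
    (d : measure_display) (S : measurableType d) (pi : scheme mu S)
    (ur : 'I_n -> R) : sender_util pi ur <= opt_util mu ur.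
Proof.
apply: ub_le_sup; last by do 3 eexists.
by exists 1 => _ [d' [S' [pi' ->]]]; exact: sender_util_le1.
Qed.

Lemma opt_util_le (R : realType) (n : nat) (mu : 'I_n -> R)
    (mu_pos : forall i, 0 < mu i) (mu_sum1 : \sum_(i < n) mu i = 1)
    (ur : 'I_n -> R) (c : R) :
  (forall (d : measure_display) (S : measurableType d) (pi : scheme mu S),
    sender_util pi ur <= c) -> opt_util mu ur <= c.
Proof.
move=> h; apply: ge_sup; first exact: achievable_neq0.
by move=> _ [d [S [pi ->]]].
Qed.

Lemma le_regret (R : realType) (n : nat) (mu : 'I_n -> R)
    (mu_pos : forall i, 0 < mu i) (mu_sum1 : \sum_(i < n) mu i = 1)
    (d : measure_display) (S : measurableType d) (pi : scheme mu S)
    (ur : 'I_n -> R) : opt_util mu ur - sender_util pi ur <= regret pi.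
Proof.
apply: ub_le_sup; last by exists ur.
exists 1 => _ [ur' _ <-].
have : opt_util mu ur' <= 1.
  by apply: opt_util_le => // *; exact: sender_util_le1.
by have := sender_util_ge0 mu_pos pi ur'; lra.
Qed.

Lemma regret_ge0 (R : realType) (n : nat) (mu : 'I_n -> R)
    (mu_pos : forall i, 0 < mu i) (mu_sum1 : \sum_(i < n) mu i = 1)
    (d : measure_display) (S : measurableType d) (pi : scheme mu S) :
  0 <= regret pi.
Proof.
apply: le_trans (le_regret mu_pos mu_sum1 pi (fun=> 0)).
by rewrite subr_ge0; exact: sender_util_le_opt.
Qed.

Lemma regret_le (R : realType) (n : nat) (mu : 'I_n -> R)
    (d : measure_display) (S : measurableType d) (pi : scheme mu S) (c : R) :
  (forall ur, opt_util mu ur - sender_util pi ur <= c) -> regret pi <= c.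
Proof.
move=> h; apply: ge_sup; last by move=> _ [ur _ <-].
by exists (opt_util mu (fun=> 0) - sender_util pi (fun=> 0)), (fun=> 0).
Qed.

(** * Upper bound: the scheme with n + 1 signals *)

(* For v <= q <= mu, the vector q lies in the cone spanned by the n + 1 signals
   v / (n + 1) and v / (n + 1) + (mu_k - v_k) e_k. *)
Lemma cone_neg (R : realFieldType) (n : nat) (mu v q ur : 'I_n -> R) :
  (forall i, v i <= q i <= mu i) ->
  \sum_(i < n) v i * ur i < 0 ->
  (forall k, (\sum_(i < n) v i * ur i) / n.+1%:R + (mu k - v k) * ur k < 0) ->
  \sum_(i < n) q i * ur i < 0.
Proof.
set W := \sum_(i < n) v i * ur i => vq W0 Wk.
have W1 : W / n.+1%:R < 0 by rewrite pmulr_llt0 // invr_gt0 ltr0n.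
have -> : \sum_(i < n) q i * ur i = W + \sum_(i < n) (q i - v i) * ur i.
  by rewrite -big_split /=; apply: eq_bigr => i _; ring.
(* Each of the n states costs at most one share [- W / n.+1] of the n + 1 available, so one negative
   share survives. *)
apply: (@le_lt_trans _ _ (W + \sum_(i < n) - (W / n.+1%:R))).
  rewrite lerD2l; apply: ler_sum => i _.
  have /andP[vi qi] := vq i; rewrite lerNr.
  have [ui|ui] := leP (ur i) 0.
    by rewrite (le_trans (ltW W1)) // oppr_ge0 mulr_ge0_le0 // subr_ge0.
  apply: (@le_trans _ _ (- ((mu i - v i) * ur i))).
    by rewrite lerNr -subr_le0 opprK addrC ltW.
  by rewrite lerN2 ler_pM2r // lerB.
rewrite sumr_const card_ord mulNrn.
have -> : W - W / n.+1%:R *+ n = W / n.+1%:R.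
  rewrite -mulr_natr -natr1; field.
  by rewrite natr1 pnatr_eq0.
by [].
Qed.

Lemma robust_scheme (R : realType) (n : nat) (mu : 'I_n -> R)
    (mu_pos : forall i, 0 < mu i) (mu_sum1 : \sum_(i < n) mu i = 1) :
  exists pi : scheme mu nat, forall ur,
    opt_util mu ur - sender_util pi ur <= 1 - 1 / (4 * n%:R ^+ 2).
Proof.
set e := 1 / (4 * n%:R ^+ 2).
have n1 : 1 <= n%:R :> R by rewrite ler1n (prior_size_gt0 mu_sum1).
have e0 : 0 < e by rewrite divr_gt0 // mulr_gt0 // exprn_gt0 //; lra.
(* [v] bounds from below the adopted masses of any scheme with utility above [1 - e]. *)
pose v i := Num.max 0 (mu i - e).
have v0 i : 0 <= v i by rewrite le_max lexx.
have vmu i : v i <= mu i.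
  by rewrite ge_max ltW //= gerBl ltW.
(* Signal 0 is the bare share of [v]; signal [i.+1] also carries the residual mass of state [i].
   Beyond n the bare share is repeated as a default. *)
pose w (s : nat) i := v i / n.+1%:R + (s == i.+1)%:R * (mu i - v i).
have w_ge s i : v i / n.+1%:R <= w s i.
  by rewrite lerDl mulr_ge0 // ?ler0n // subr_ge0.
(* This needs [(2n + 1) e <= 1], which holds since [n e] and [e] are both at most 1/4. *)
have eV : e <= (\sum_(i < n) v i) / n.+1%:R.
  have V : 1 - n%:R * e <= \sum_(i < n) v i.
    rewrite mulr_natl -[X in _ *+ X]card_ord -sumr_const -[X in X - _]mu_sum1 -sumrB.
    by apply: ler_sum => i _; rewrite le_max lexx orbT.
  rewrite ler_pdivlMr ?ltr0n // -natr1; apply: le_trans V.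
  have : e * n%:R <= 1 / 4.
    have -> : e * n%:R = 1 / 4 / n%:R by rewrite /e; field; lra.
    by rewrite ler_pdivrMr //; lra.
  have : e <= 1 / 4.
    by rewrite /e ler_pdivrMr; nra.
  by lra.
have w_tot s : e <= \sum_(i < n) w s i.
  by apply: le_trans eV _; rewrite mulr_suml; apply: ler_sum.
have w_sum i : \sum_(s < n.+1) w s i = mu i.
  rewrite big_split /= sumr_const card_ord -mulr_suml.
  rewrite (bigD1 (lift ord0 i)) //= eqxx big1 ?addr0; last first.
    move=> s sl; suff -> : (s == i.+1 :> nat) = false by [].
    by apply: contraNF sl => /eqP E; apply/eqP/val_inj.
  by rewrite -[_ / _ *+ n.+1]mulr_natr divfK ?pnatr_eq0 // mul1r addrC subrK.
have [| | |pi piE] := @discrete_scheme R n n.+1 mu mu_pos w.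
- by move=> s i; apply: le_trans (w_ge s i); rewrite divr_ge0.
- by move=> s; exact: lt_le_trans (w_tot s).
- exact: w_sum.
exists pi => ur.
have opt1 : opt_util mu ur <= 1.
  by apply: opt_util_le => // *; exact: sender_util_le1.
(* One adopted signal already yields utility [e]; if there is none, the optimum itself must be at
   most [1 - e]. *)
have [/existsP[s ws]|/existsPn no] :=
  boolP [exists s : 'I_n.+1, 0 <= \sum_(i < n) w s i * ur i].
  suff : e <= sender_util pi ur by lra.
  rewrite piE (bigD1 s) //= (le_trans (w_tot s)) // lerDl.
  by apply: sumr_ge0 => t _; exact: le_trans (ltW e0) (w_tot t).
suff : opt_util mu ur <= 1 - e by have := sender_util_ge0 mu_pos pi ur; lra.
apply: opt_util_le => // d S pi'; rewrite leNgt; apply/negP => big_util.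
have := obedience mu_pos pi' ur; apply/negP; rewrite -ltNge.
have aP i := adopt_prob_itv pi' ur i.
have qmu i : mu i * adopt_prob pi' ur i <= mu i.
  by rewrite ler_piMr ?(ltW (mu_pos i)) //; case/andP: (aP i).
have W s : \sum_(i < n) w s i * ur i =
   (\sum_(i < n) v i * ur i) / n.+1%:R +
     \sum_(i < n) (s == i.+1)%:R * ((mu i - v i) * ur i).
  rewrite mulr_suml -big_split /=; apply: eq_bigr => i _.
  by rewrite /w; ring.
apply: (@cone_neg _ _ mu v).
- move=> i; rewrite qmu andbT ge_max mulr_ge0 ?(ltW (mu_pos i)) //=; last by case/andP: (aP i).
  (* The mass lost at one state is at most the total mass lost, all losses being nonnegative. *)
  have : mu i - mu i * adopt_prob pi' ur i <= 1 - sender_util pi' ur.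
    rewrite -mu_sum1 -sumrB (bigD1 i) //= lerDl; apply: sumr_ge0 => j _.
    by rewrite subr_ge0 qmu.
  by lra.
- have := no ord0; rewrite -ltNge W [X in _ + X]big1 ?addr0.
    by rewrite pmulr_llt0 // invr_gt0 ltr0n.
  by move=> i _; rewrite mul0r.
- move=> k; have := no (lift ord0 k); rewrite -ltNge W [X in _ + X](bigD1 k) //=.
  rewrite eqxx mul1r [X in _ + (_ + X)]big1 ?addr0 // => i ik.
  by rewrite /bump /= add1n eqSS (inj_eq (@ord_inj n)) eq_sym (negbTE ik) mul0r.
Qed.

(** * Lower bound: baits on a light set of states *)

(** Start from all states and discard the heaviest remaining one repeatedly: the average mass never
    increases. The induction is on the number of discarded states. *)
Lemma light_subset (R : realType) (n : nat) (mu : 'I_n -> R) (m : nat) :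
  (m <= n)%N ->
  exists2 L : {set 'I_n}, #|L| = m &
    n%:R * \sum_(i in L) mu i <= m%:R * \sum_(i < n) mu i.
Proof.
move=> mn; rewrite -(subKn mn); elim: (n - m)%N (leq_subr m n) => [_|k IH kn].
  exists [set: 'I_n]; rewrite ?cardsT ?card_ord subn0 //.
  by rewrite (eq_bigl xpredT) // => i; rewrite finset.in_setT.
have [L cL hL] := IH (ltnW kn).
have [j0 j0L] : exists j0, j0 \in L.
  by apply/set0Pn; rewrite -card_gt0 cL subn_gt0.
have [j /= jL jmax] := @Order.TotalTheory.arg_maxP _ _ _ j0 (fun j => j \in L) mu j0L.
exists (L :\ j).
  by move: (cardsD1 j L); rewrite jL cL subnS => ->.
have hj : \sum_(i in L) mu i <= (n - k)%:R * mu j.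
  rewrite mulr_natl -cL -sumr_const; apply: ler_sum => i iL; exact: jmax.
move: hL hj; rewrite (big_setD1 j) //= subnS.
have : (0 < n - k)%N by rewrite subn_gt0.
case: (n - k)%N => // p _; rewrite -natr1 /=.
set T := \sum_(i < n) mu i; set A := \sum_(i in L :\ j) mu i => hL hj.
have p1 : 0 < p%:R + 1 :> R by rewrite natr1 ltr0n.
rewrite -(ler_pM2l p1).
have p0 : 0 <= p%:R :> R by rewrite ler0n.
have n0 : 0 <= n%:R :> R by rewrite ler0n.
have h1 : A <= p%:R * mu j by lra.
have h2 : p%:R * (n%:R * (mu j + A)) <= p%:R * ((p%:R + 1) * T).
  exact: ler_wpM2l.
have h3 : n%:R * A <= n%:R * (p%:R * mu j) by exact: ler_wpM2l.
lra.
Qed.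

(* The factor 2 makes adoption under bait i force p_i / mu_i >= 2 p_k / mu_k for
   every other k in L, so that two such utilities are never adopted together. *)
Definition bait (R : realType) (n : nat) (mu : 'I_n -> R) (L : {set 'I_n})
    (i : 'I_n) : 'I_n -> R :=
  fun j => if j == i then (mu i)^-1 else if j \in L then - 2 / mu j else -1.

Lemma bait_lt0 (R : realType) (n : nat) (mu : 'I_n -> R)
    (mu_pos : forall i, 0 < mu i) (L : {set 'I_n}) (i j : 'I_n) :
  j != i -> bait mu L i j < 0.
Proof.
rewrite /bait => /negbTE ->; case: ifP => _; last by rewrite oppr_lt0.
by rewrite pmulr_llt0 ?invr_gt0.
Qed.

Lemma adopts_bait_ratio (R : realType) (n : nat) (mu : 'I_n -> R)
    (mu_pos : forall i, 0 < mu i) (L : {set 'I_n}) (p : 'I_n -> R)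
    (p_ge0 : forall j, 0 <= p j) (i k : 'I_n) :
  k \in L -> k != i -> adopts (bait mu L i) p -> 2 * (p k / mu k) <= p i / mu i.
Proof.
move=> kL ki; rewrite /adopts (bigD1 i) // (bigD1 k) //=.
rewrite {1 2}/bait eqxx (negbTE ki) kL.
set X := \sum_(_ < n | _) _.
have : X <= 0.
  apply: sumr_le0 => j /andP[ji _]; rewrite mulr_ge0_le0 //.
  by rewrite ltW // bait_lt0.
lra.
Qed.

(** For distinct [i] and [k] the two ratio bounds force [p i = 0]. Bait [i] is negative at every
    other state, so its adoption then makes [p] vanish everywhere. *)
Lemma adopts_bait_disjoint (R : realType) (n : nat) (mu : 'I_n -> R)
    (mu_pos : forall i, 0 < mu i) (L : {set 'I_n}) (p : 'I_n -> R)
    (p_ge0 : forall j, 0 <= p j) (p_sum1 : \sum_(j < n) p j = 1) (i k : 'I_n) :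
  i \in L -> k \in L ->
  adopts (bait mu L i) p -> adopts (bait mu L k) p -> i = k.
Proof.
move=> iL kL ai ak; apply/eqP; apply: contraT => ik.
have ki : k != i by rewrite eq_sym.
have hik := adopts_bait_ratio mu_pos p_ge0 kL ki ai.
have hki := adopts_bait_ratio mu_pos p_ge0 iL ik ak.
have pi0 : p i = 0.
  have : p i / mu i = 0.
    apply/eqP; rewrite eq_le divr_ge0 ?(ltW (mu_pos i)) // andbT.
    lra.
  by move/eqP; rewrite mulf_eq0 invr_eq0 (gt_eqF (mu_pos i)) orbF => /eqP.
have le0 j : p j * bait mu L i j <= 0.
  have [->|ji] := eqVneq j i; first by rewrite pi0 mul0r.
  by rewrite mulr_ge0_le0 // ltW // bait_lt0.
have s0 : \sum_(j < n) - (p j * bait mu L i j) = 0.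
  apply/eqP; rewrite eq_le sumr_ge0 ?andbT; last by move=> j _; rewrite oppr_ge0.
  by rewrite sumrN oppr_le0.
have p0 j : p j = 0.
  have [->//|ji] := eqVneq j i.
  have /eqP := s0; rewrite psumr_eq0; last by move=> l _; rewrite oppr_ge0.
  move/allP => /(_ j (mem_index_enum _)) /=.
  by rewrite oppr_eq0 mulf_eq0 (lt_eqF (bait_lt0 mu_pos L ji)) orbF => /eqP.
by move: p_sum1; rewrite big1 // => /eqP; rewrite eq_sym oner_eq0.
Qed.

Lemma sum_sender_util_bait (R : realType) (n : nat) (mu : 'I_n -> R)
    (mu_pos : forall i, 0 < mu i) (mu_sum1 : \sum_(i < n) mu i = 1)
    (d : measure_display) (S : measurableType d) (pi : scheme mu S)
    (L : {set 'I_n}) :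
  \sum_(i in L) sender_util pi (bait mu L i) <= 1.
Proof.
rewrite exchange_big /= -mu_sum1; apply: ler_sum => j _.
rewrite -mulr_sumr ler_piMr ?(ltW (mu_pos j)) //.
pose A i := [set s | adopts (bait mu L i) (post pi s)]%classic.
have mA i : measurable (A i) by exact: measurable_adopts.
have tA : trivIset [set` enum L] A.
  move=> i k /=; rewrite !mem_enum => iL kL [s [/= ai ak]].
  by apply: (adopts_bait_disjoint mu_pos _ _ iL kL ai ak);
    [exact: post_ge0 | exact: post_sum1].
have : (sig pi j (\bigcup_(i in [set` enum L]) A i)%classic <= 1)%E.
  by apply: probability_le1; apply: fin_bigcup_measurable.
rewrite measure_fin_bigcup // -fsbig_seq ?enum_uniq //= big_enum /=.
rewrite -lee_fin -sumEFin; congr (_ <= _)%E; apply: eq_bigr => i _.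
exact/esym/fineK/fin_num_measure/mA.
Qed.

Lemma opt_util_bait (R : realType) (n : nat) (mu : 'I_n -> R)
    (mu_pos : forall i, 0 < mu i) (mu_sum1 : \sum_(i < n) mu i = 1)
    (L : {set 'I_n}) (i : 'I_n) : (1 < #|L|)%N -> i \in L ->
  1 - \sum_(j in L :\ i) mu j <= opt_util mu (bait mu L i).
Proof.
move=> L1 iL; set K := L :\ i.
have iK : i \notin K by rewrite !inE eqxx.
(* Signal 0 reveals that the state is outside [K], signal 1 that it is in [K]; both have positive
   mass because [L] has a second element. *)
pose w (s : nat) j := if (s == 0)%N == (j \in K) then 0 else mu j.
have w_ge0 s j : 0 <= w s j by rewrite /w; case: ifP => // _; exact: ltW.
have w_gt0 s : 0 < \sum_(j < n) w s j.
  have [k kK] : exists k, k \in K.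
    by apply/set0Pn; rewrite -card_gt0; move: L1; rewrite (cardsD1 i) iL.
  pose l := if s == 0%N then i else k.
  have wl : w s l = mu l.
    by rewrite /w /l; case: (s == 0%N); rewrite ?(negbTE iK) ?kK.
  rewrite (bigD1 l) //= wl ltr_wpDr //; exact: sumr_ge0.
have w_sum j : \sum_(s < 2) w s j = mu j.
  rewrite !big_ord_recl big_ord0 /w /= addr0.
  by case: (j \in K); rewrite /= ?add0r ?addr0.
have [pi piE] := discrete_scheme mu_pos w_ge0 w_gt0 w_sum.
apply: le_trans (sender_util_le_opt mu_pos mu_sum1 pi _); rewrite piE.
rewrite (bigD1 ord0) /=; last first.
  (* Signal 0 is adopted: state [i] contributes 1, while the states outside [L] subtract at most the
     total prior mass 1. The comparison with this zero sum is termwise. *)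
  have s0 : \sum_(j < n) ((j == i)%:R - mu j) = 0.
    rewrite sumrB mu_sum1 (bigD1 i) //= eqxx big1 ?addr0 ?subrr //.
    by move=> j /negbTE ->.
  rewrite -[leLHS]s0; apply: ler_sum => j _; rewrite /w /bait.
  have [->|ji] := eqVneq j i.
    rewrite (negbTE iK) /= mulfV ?gt_eqF // gerBl; exact: ltW.
  rewrite !inE ji /=; case: (j \in L) => /=; last by rewrite mulrN1 sub0r.
  by rewrite mul0r sub0r oppr_le0 ltW.
rewrite -[leLHS]addr0; apply: lerD; last first.
  by apply: sumr_ge0 => s _; exact: ltW.
rewrite -mu_sum1 [X in _ - X]big_mkcond -sumrB; apply: ler_sum => j _.
by rewrite /w /=; case: (j \in K); rewrite /= ?subrr ?subr0.
Qed.

(** Sum the regrets against the k + 1 baits: the optima total at least [(k + 1)(1 - m) + m], and the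
    utilities of [pi] total at most 1. *)
Lemma regret_light_subset (R : realType) (n : nat) (mu : 'I_n -> R)
    (mu_pos : forall i, 0 < mu i) (mu_sum1 : \sum_(i < n) mu i = 1)
    (d : measure_display) (S : measurableType d) (pi : scheme mu S)
    (k : nat) (L : {set 'I_n}) : (0 < k)%N -> #|L| = k.+1 ->
  k%:R * (1 - \sum_(i in L) mu i) <= k.+1%:R * regret pi.
Proof.
move=> k0 cL; set m := \sum_(i in L) mu i.
have -> : k.+1%:R * regret pi = \sum_(i in L) regret pi.
  by rewrite sumr_const cL mulr_natl.
have h i : i \in L ->
    1 - m + mu i - sender_util pi (bait mu L i) <= regret pi.
  move=> iL; apply: le_trans (le_regret mu_pos mu_sum1 pi (bait mu L i)).
  rewrite lerD2r; apply: le_trans (opt_util_bait mu_pos mu_sum1 _ iL).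
    by rewrite /m (big_setD1 i) //=; lra.
  by rewrite cL.
apply: (@le_trans _ _
  (\sum_(i in L) (1 - m + mu i - sender_util pi (bait mu L i)))); last first.
  exact: ler_sum.
rewrite sumrB big_split /= sumr_const cL -/m.
have := sum_sender_util_bait mu_pos mu_sum1 pi L.
rewrite -[(1 - m) *+ _]mulr_natl -natr1; lra.
Qed.

Lemma regret_lower_bound (R : realType) (n : nat) (mu : 'I_n -> R)
    (mu_pos : forall i, 0 < mu i) (mu_sum1 : \sum_(i < n) mu i = 1)
    (d : measure_display) (S : measurableType d) (pi : scheme mu S) :
  1 - 2 / Num.sqrt n%:R <= regret pi.
Proof.
set r : R := Num.sqrt n%:R.
have n0 := prior_size_gt0 mu_sum1.
have r1 : 1 <= r by rewrite -sqrtr1 ler_sqrt ?ler1n ?ler0n.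
have rr : r ^+ 2 = n%:R by rewrite sqr_sqrtr ?ler0n.
have /Num.Theory.truncn_itv /andP[kr rk] : 0 <= r by lra.
set k := Num.truncn r in kr rk.
have k0 : (0 < k)%N by rewrite truncn_gt0.
(* A set of k + 1 states needs [k < n]. Otherwise [r = 1], and the claimed bound is negative. *)
have [kn|nk] := ltnP k n; last first.
  apply: le_trans (regret_ge0 mu_pos mu_sum1 pi).
  have : r ^+ 2 <= r by rewrite rr (le_trans _ kr) // ler_nat.
  move=> h; have -> : r = 1 by nra.
  lra.
have [L cL hL] := light_subset mu kn.
have := regret_light_subset mu_pos mu_sum1 pi k0 cL.
move: hL; rewrite mu_sum1 mulr1 -rr; set m := \sum_(i in L) mu i => hL hreg.
have k1 : 0 < k.+1%:R :> R by rewrite ltr0n.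
rewrite -(ler_pM2l k1); apply: le_trans hreg.
have hm : m <= k.+1%:R / r ^+ 2 by rewrite ler_pdivlMr ?exprn_gt0 //; lra.
have hk : 0 <= k%:R :> R by rewrite ler0n.
(* Of the two losses of [(k + 1) / r], one covers [k m] through [k <= r], the other covers 1 through
   [r < k + 1]. *)
have h1 : k%:R * m <= k.+1%:R / r.
  apply: le_trans (ler_wpM2l hk hm) _.
  have -> : k%:R * (k.+1%:R / r ^+ 2) = k.+1%:R / r * (k%:R / r) by field; lra.
  rewrite ler_piMr // ?divr_ge0 //; try lra.
  by rewrite ler_pdivrMr ?mul1r //; lra.
have h2 : 1 <= k.+1%:R / r by rewrite ler_pdivlMr ?mul1r ?ltW //; lra.
move: h1 h2; rewrite -natr1 => h1 h2.
have -> : (k%:R + 1) * (1 - 2 / r) = (k%:R + 1) - 2 * ((k%:R + 1) / r) by ring.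
lra.
Qed.

Theorem theorem1 (R : realType) (n : nat) (mu : 'I_n -> R)
    (mu_pos : forall i, 0 < mu i) (mu_sum1 : \sum_(i < n) mu i = 1) :
  1 - 2 / Num.sqrt (n%:R) <= Reg_AR mu /\
  Reg_AR mu <= 1 - 1 / (4 * (n%:R) ^+ 2).
Proof.
have [pi hpi] := robust_scheme mu_pos mu_sum1.
split.
  apply: lb_le_inf; first by exists (regret pi); do 3 eexists.
  by move=> _ [d [S [pi' ->]]]; exact: regret_lower_bound.
apply: le_trans (regret_le hpi); apply: ge_inf; last by do 3 eexists.
by exists 0 => _ [d [S [pi' ->]]]; exact: regret_ge0.
Qed.
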